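(* Let $p$ be a prime and let $\mathcal{F}$ be a saturated fusion system on a finite $p$-group $P$. If $\mathrm{N}_{\mathcal F}(P)$ is trivial, then $\mathrm{N}_{\mathcal F}(Q)$ is trivial for every subgroup $Q$ with $P' \leq Q \leq \Phi(P)$.
   Context: $P'$ is the derived subgroup of $P$ and $\Phi(P)$ its Frattini subgroup. Fusion systems. Let $\mathcal{F}$ be a category whose objects are the subgroups of $P$, where $\mathrm{Hom}_{\mathcal F}(Q,R)$ is a set of injective group homomorphisms $Q\to R$ and composition is composition of maps. Write $Q^{\mathcal F}$ for the $\mathcal F$-isomorphism class of $Q$, $\mathrm{Hom}_P(Q,R)$ for the homomorphisms $Q\to R$ induced by conjugation by elements of $P$, and $\mathrm{Aut}_P(Q)$ for the automorphisms of $Q$ induced by conjugation by elements of $\mathrm N_P(Q)$. A subgroup $Q$ is fully $\mathcal F$-normalized if $|\mathrm N_P(Q)|\ge|\mathrm N_P(R)|$ for all $R\in Q^{\mathcal F}$. $\mathcal F$ is a saturated fusion system on $P$ if for all $Q,R\le P$: (a) if $Q\le R$, the inclusion $Q\to R$ is in $\mathcal F$; (b) if $\phi\in\mathrm{Hom}_{\mathcal F}(Q,R)$, then the induced isomorphism $Q\to\phi(Q)$ and its inverse are in $\mathcal F$; (c) $\mathrm{Hom}_P(Q,R)\subseteq\mathrm{Hom}_{\mathcal F}(Q,R)$; (d) $\mathrm{Aut}_P(P)$ is a Sylow $p$-subgroup of $\mathrm{Aut}_{\mathcal F}(P)$; (e) every $\phi\in\mathrm{Hom}_{\mathcal F}(Q,P)$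 with $\phi(Q)$ fully $\mathcal F$-normalized extends to a morphism in $\mathrm{Hom}_{\mathcal F}(N_\phi,P)$, where $N_\phi$ is the inverse image in $\mathrm N_P(Q)$ of $\mathrm{Aut}_P(Q)\cap(\phi^{-1}\mathrm{Aut}_P(\phi(Q))\phi)$. For $Q\le P$, $\mathrm N_{\mathcal F}(Q)$ is the category with objects the subgroups of $\mathrm N_P(Q)$ and morphisms $R\to S$ those $\phi\in\mathrm{Hom}_{\mathcal F}(R,S)$ for which there is $\varphi\in\mathrm{Hom}_{\mathcal F}(QR,QS)$ with $\varphi|_R=\phi$ and $\varphi(Q)=Q$. Here all $Q$ considered are normal in $P$, so $\mathrm N_{\mathcal F}(Q)$ is a saturated fusion system on $P$. A saturated fusion system on $P$ is trivial if it equals $\mathcal F_P(P)$, the fusion system whose morphisms are exactly those in $\mathrm{Hom}_P(Q,R)$, $Q,R\le P$. *)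

(* Defs.v *)
From mathcomp Require Import all_boot all_fingroup all_solvable.

Set Implicit Arguments.
Unset Strict Implicit.
Unset Printing Implicit Defensive.

Import GroupScope.

Section FusionDefs.

Variable gT : finGroupType.
Implicit Types (P Q R S : {group gT}) (f g : {ffun gT -> gT}).

(* A map defined on Q is encoded as the finite function on gT that agrees with *)
(* it on Q and is 1 outside Q; [resf Q f] puts a function in this form. Two    *)
(* maps on Q are thus equal exactly when their encodings are.                  *)
Definition resf Q (f : gT -> gT) : {ffun gT -> gT} :=
  [ffun x => if x \in Q then f x else 1].

Definition injhom Q R f : Prop :=
  [/\ resf Q f = f, {in Q &, {morph f : x y / x * y}},
      {in Q &, injective f} & f @: Q \subset R].

(* The group f(Q). For f a homomorphism on Q the generated-subgroup brackets   *)
(* do not change the underlying set (lemma [imgGE]).                           *)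
Definition imgG f Q : {group gT} := [group of <<f @: Q>>].

Lemma imgGE f Q :
  {in Q &, {morph f : x y / x * y}} -> imgG f Q = f @: Q :> {set gT}.
Proof.
move=> fM; apply: gen_set_id; apply/group_setP; split=> [|y1 y2].
  have f1 : f 1 = 1 by apply: (mulgI (f 1)); rewrite -fM ?group1 ?mulg1.
  by rewrite -f1 imset_f.
by case/imsetP=> x Qx -> /imsetP[y Qy ->]; rewrite -fM ?imset_f ?groupM.
Qed.

(* [F Q R] is Hom_F(Q, R). In a category on P only the values at Q, R <= P are *)
(* meaningful.                                                                 *)
Definition homsets := {group gT} -> {group gT} -> {set {ffun gT -> gT}}.
Implicit Type F : homsets.

Record is_category P F : Prop := IsCategory {
  cat_injhom : forall Q R f, Q \subset P -> R \subset P ->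
    f \in F Q R -> injhom Q R f;
  cat_id : forall Q, Q \subset P -> resf Q id \in F Q Q;
  cat_comp : forall Q R S f g, Q \subset P -> R \subset P -> S \subset P ->
    f \in F Q R -> g \in F R S -> resf Q (g \o f) \in F Q S
}.

Definition Fisomorphic F Q R : Prop :=
  exists f g, [/\ f \in F Q R, g \in F R Q, {in Q, cancel f g} &
                  {in R, cancel g f}].

Definition fully_normalized P F Q : Prop :=
  forall R, R \subset P -> Fisomorphic F Q R -> #|'N_P(R)| <= #|'N_P(Q)|.

(* Hom_P(Q, R); also the hom-sets of the fusion system F_P(P).                 *)
Definition homP P : homsets := fun Q R =>
  [set resf Q (conjg^~ x) | x in P & Q :^ x \subset R].

(* Automorphism groups use the library's encoding of Aut Q: permutations of gT *)
(* fixing every element outside Q.                                             *)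
Definition autF F Q : {set {perm gT}} := [set a in Aut Q | resf Q a \in F Q Q].
Definition autP P Q : {set {perm gT}} := conj_aut Q @* 'N_P(Q).

(* phi^-1 Aut_P(phi(Q)) phi: the a in Aut Q with phi o a = b o phi for some b  *)
(* in Aut_P(phi(Q)), maps being composed from right to left.                   *)
Definition autP_transport P Q f : {set {perm gT}} :=
  [set a in Aut Q |
    [exists b in autP P (imgG f Q), [forall u in Q, f (a u) == b (f u)]]].

Definition Nphi_set P Q f : {set gT} :=
  'N_P(Q) :&: conj_aut Q @*^-1 (autP P Q :&: autP_transport P Q f).

(* The brackets do not change the set when f is a homomorphism on Q (lemma     *)
(* [NphiE]).                                                                   *)
Definition Nphi P Q f : {group gT} := [group of <<Nphi_set P Q f>>].

Lemma NphiE P Q f : {in Q &, {morph f : x y / x * y}} ->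
  Nphi P Q f = Nphi_set P Q f :> {set gT}.
Proof.
move=> fM; apply: gen_set_id.
suff gTr : group_set (autP_transport P Q f).
  exact: (groupP ('N_P(Q) :&:
     conj_aut Q @*^-1 (conj_aut Q @* 'N_P(Q) :&: Group gTr))%G).
apply/group_setP; split=> [|a b].
  rewrite inE group1; apply/existsP; exists 1.
  by rewrite group1; apply/forall_inP=> u _; rewrite !perm1.
rewrite inE => /andP[Aa /existsP[a' /andP[Pa' /forall_inP Ea]]].
rewrite inE => /andP[Ab /existsP[b' /andP[Pb' /forall_inP Eb]]].
rewrite inE groupM //; apply/existsP; exists (a' * b').
rewrite (@groupM _ (conj_aut (imgG f Q) @* 'N_P(imgG f Q))%G) //.
apply/forall_inP=> u Qu; rewrite !permM (eqP (Eb _ _)) ?(eqP (Ea _ _)) //.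
by rewrite Aut_closed.
Qed.

Record saturated (p : nat) P F : Prop := Saturated {
  sat_category : is_category P F;
  sat_incl : forall Q R, R \subset P -> Q \subset R -> resf Q id \in F Q R;
  sat_iso : forall Q R f, Q \subset P -> R \subset P -> f \in F Q R ->
    f \in F Q (imgG f Q) /\
    exists2 g, g \in F (imgG f Q) Q & {in Q, cancel f g};
  sat_homP : forall Q R, Q \subset P -> R \subset P ->
    homP P Q R \subset F Q R;
  sat_Sylow : p.-Sylow(autF F P) (autP P P);
  sat_ext : forall Q f, Q \subset P -> f \in F Q P ->
    fully_normalized P F (imgG f Q) ->
    exists2 g, g \in F (Nphi P Q f) P & resf Q g = f
}.

(* N_F(Q). Its objects are the subgroups of N_P(Q); the hom-sets are taken to *)
(* be empty elsewhere; for objects R, S, which normalize Q, the joins          *)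
(* [(Q * R)%G], [(Q * S)%G] are the product sets QR, QS.                       *)
Definition normF P F Q : homsets := fun R S =>
  [set f in F R S | [&& R \subset 'N_P(Q), S \subset 'N_P(Q) &
    [exists g in F (Q * R)%G (Q * S)%G, (resf R g == f) && (g @: Q == Q)]]].

(* Equality with F_P(P) as fusion systems on P.                                *)
Definition trivial_fusion P F : Prop :=
  forall Q R, Q \subset P -> R \subset P -> F Q R = homP P Q R.

End FusionDefs.

(* Main.v *)
Require Import Defs.
From mathcomp Require Import all_boot all_fingroup all_solvable.
From mathcomp Require Import ssralg.

Set Implicit Arguments.
Unset Strict Implicit.
Unset Printing Implicit Defensive.

Import GroupScope.

(** Since Q contains P', every R between Q and P is normal in P, hence fully
normalized, and the extension axiom applies to every morphism into such an R.
A morphism of N_F(Q) extends to a morphism of F that is defined on such an R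
and maps Q to itself, so it suffices to show that the latter are conjugations
by elements of P ([hom_inner]).

An F-automorphism of R that normalizes Aut_P(R) extends to P, where it is
inner because N_F(P) is trivial. Thus Aut_P(R) is self-normalizing in
Aut_F(R) ([autP_self_normalizing]), and so it is a Sylow subgroup of the group
K_R of the F-automorphisms of R that act trivially on R/Q. Given f on R with
f(Q) = Q, Sylow's theorem in K_{f(R)} lets one correct f by an element of
K_{f(R)} so that it extends to P; as inner automorphisms of P act trivially on
P/Q, f itself acts trivially on R/Q ([hom_trivial_mod]).

It remains to see that K_R is a p-group, and, by coprime action, that
Aut_F(Q) is one. Let I be the image of Q in Aut_F(Q). It is a normal subgroup
and lies in the Frattini subgroup of Aut_P(Q); modulo I, the Sylow subgroup
Aut_P(Q) of Aut_F(Q) is abelian and self-normalizing.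
By Burnside's transfer theorem and a Frattini argument, Aut_F(Q) has a normal
p-complement H ([normal_complement_of_Frattini]), and H centralizes I.

To see that H = 1, extend each h in H to a morphism g_h on the centralizer D_h
of h in P. Then x |-> x^-1 g_h(x) is a crossed homomorphism from D_h to Z(Q).
The corestrictions to P of these, over representatives h of the P-orbits on H,
add up to a crossed homomorphism d on P that maps v in Z(Q) to
N(v) - |H| v, where N is the norm of H ([corestricted_crossed_hom]). Let C be
the group of fixed points of H in Z(Q). As |H| is invertible on Z(Q), the
subgroup of the x in P with d(x) in C covers P/Z(Q); as Z(Q) lies in Phi(P),
it is P. Hence |H| Z(Q) is contained in C, so H centralizes Z(Q)
([center_fixed_of_crossed_homs]). As H also centralizes Q/Z(Q), it is
trivial ([p'_autF_base_trivial]). This is a stable-element argument for the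
class of P in H^2(P/Z(Q), Z(Q)), carried out inside P. *)

(** * Normal p-complements *)

Section GroupTheory.
Import FiniteModule.

(** The transfer of G into S maps g in S to g ^+ #|G : S|, since conjugates of
g that lie in S are conjugate under 'N_G(S) and hence equal to g. So it is
bijective on S, and its kernel is the complement. *)
Lemma Burnside_selfnormalizing_abelian_Sylow (p : nat) (gT : finGroupType)
    (G S : {group gT}) :
    p.-Sylow(G) S -> abelian S -> 'N_G(S) \subset S ->
  exists K : {group gT}, [/\ K <| G, p^'.-group K & K * S = G].
Proof.
move=> sylS abS sNS; have [sSG pS _] := and3P sylS.
have abSi : abelian (idm S @* S) by rewrite morphim_idm.
pose t := transfer_morphism G abSi.
have fM : {in G &, {morph (fun x => fmval (t x)) : x y / x * y}}.
  by move=> x y Gx Gy; rewrite morphM.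
pose f := Morphism fM.
(* S and its conjugate under y^-1 are both Sylow subgroups of 'C_G[g]. *)
have conjS g y : g \in S -> y \in G -> g ^ y \in S -> g ^ y = g.
  move=> Sg Gy Sgy.
  have sSC : S \subset 'C_G[g].
    by rewrite subsetI sSG sub_cent1 (subsetP abS).
  have sSyC : S :^ y^-1 \subset 'C_G[g].
    have -> : S :^ y^-1 \subset 'C_G[g] = (S :^ y^-1 \subset 'C[g]).
      by rewrite subsetI -{1}(conjGid (groupVr Gy)) conjSg sSG.
    rewrite sub_cent1 centJ mem_conjgV.
    exact: (subsetP abS).
  have sylC : p.-Sylow('C_G[g]) S by apply: pHall_subl sylS; rewrite ?subsetIl.
  have sylCy : p.-Sylow('C_G[g]) (S :^ y^-1).
    by apply: pHall_subl sSyC (subsetIl _ _) _; rewrite pHallJ ?groupV.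
  have [c /setIP[Gc /cent1P cgc] defSy] := Sylow_trans sylC sylCy.
  have Scy : c * y \in S.
    apply: (subsetP sNS); rewrite inE groupM //; apply/normP.
    by rewrite conjsgM -defSy conjsgKV.
  have -> : y = c^-1 * (c * y) by rewrite mulKg.
  rewrite conjgM (_ : g ^ c^-1 = g); first exact/conjg_fixP/commgP/(centsP abS).
  by apply/conjg_fixP/commgP/commuteV.
have fS g : g \in S -> f g = g ^+ #|G : S|.
  move=> Sg; have Gg := subsetP sSG g Sg.
  have trX := transversalP (rcosets_cycle_partition sSG Gg).
  set X := transversal _ _ in trX.
  rewrite /= (transfer_cycle_expansion sSG abSi Gg trX).
  rewrite -(sum_index_rcosets_cycle sSG Gg trX).
  have Sig : g \in idm S @* S by rewrite morphim_idm.
  rewrite (eq_bigr (fun x => fmod abSi g *+ #|<[g]> : S :* x|)%R).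
    by rewrite GRing.sumrMnr fmvalZ fmodK.
  move=> x Xx; have Gx := subsetP (transversal_sub trX) x Xx.
  have Sgx : (g ^+ #|<[g]> : S :* x|) ^ x^-1 \in S.
    rewrite conjgE invgK mulgA -mem_rcoset; exact: mulg_exp_card_rcosets.
  by rewrite conjS ?groupX ?groupV //; apply: fmodX.
have imG : f @* G \subset S.
  apply/subsetP=> _ /morphimP[x _ _ ->].
  by case/morphimP: (fmodP (t x)) => y _ Sy /= ->.
have coSi : coprime #|S| #|G : S|.
  by have [_ _ p'i] := and3P sylS; apply: pnat_coprime pS p'i.
have imS : S \subset f @* S.
  apply/subsetP=> x Sx.
  rewrite -(expgK coSi Sx) -expgM mulnC expgM -fS ?groupX //.
  by apply: mem_morphim; rewrite /= ?groupX ?(subsetP sSG).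
exists ('ker f)%G; split; first exact: ker_normal.
- have tiKS : 'ker f :&: S = 1.
    apply/trivgP/subsetP=> x /setIP[/mker fx Sx].
    by rewrite inE -(expgK coSi Sx) -fS // fx expg1n.
  have sylK : p.-Sylow('ker f) ('ker f :&: S).
    exact: Sylow_setI_normal (ker_normal f) sylS.
  rewrite tiKS in sylK.
  by rewrite /pgroup -partn_eq1 // -(card_Hall sylK) cards1.
have sKG := normal_sub (ker_normal f).
apply/eqP; rewrite eqEsubset mul_subG //= -morphimSK //.
exact: subset_trans imG imS.
Qed.

(** A special case of Tate's theorem on p-nilpotence. The quotient A / I has a
normal p-complement K / I, and a complement H of I in K is unique up to
conjugation in I, so that A = I * 'N_A(H). As I is contained in 'Phi(S), all of
S normalizes H. *)
Lemma normal_complement_of_Frattini (p : nat) (gT : finGroupType)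
    (A S I : {group gT}) :
    p.-Sylow(A) S -> 'N_A(S) \subset S -> I <| A -> I \subset 'Phi(S) ->
    S^`(1) \subset I ->
  exists H : {group gT}, [/\ H <| A, p^'.-group H & H * S = A].
Proof.
move=> sylS sNS nsIA sIPhi sS'I; have [sSA pS _] := and3P sylS.
have sIS : I \subset S := subset_trans sIPhi (Phi_sub S).
have pI := pgroupS sIS pS; have [sIA nIA] := andP nsIA.
have nIS := subset_trans sSA nIA.
have nsIS : I <| S by rewrite /normal sIS.
have [Kb [nsKb p'Kb defAb]] : exists K : {group coset_of I},
    [/\ K <| A / I, p^'.-group K & K * (S / I) = A / I].
  apply: (@Burnside_selfnormalizing_abelian_Sylow p) => //.
  - exact: quotient_pHall.
  - exact: sub_der1_abelian.
  by rewrite -quotient_normG // -quotientGI //; apply: quotientS.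
have [K defKb sIK nsKA] := inv_quotientN nsIA nsKb.
have sKA := normal_sub nsKA.
have hallI : p.-Hall(K) I.
  rewrite /pHall sIK pI -card_quotient ?(subset_trans sKA) //.
  by rewrite -defKb.
have /splitsP[H complH] : [splits K, over I].
  apply: SchurZassenhaus_split (pHall_Hall hallI) _.
  exact: normalS sIK (normal_sub nsKA) nsIA.
have hallH : p^'.-Hall(K) H by rewrite -(compl_pHall H hallI).
have [_ defK] := complP complH.
have [sHK p'H _] := and3P hallH.
have sHA : H \subset A := subset_trans sHK sKA.
have Frat : A \subset 'N_A(H) * I.
  apply/subsetP=> a Aa.
  have [x Ix defHa] : exists2 x, x \in I & H :^ a = H :^ x.
    apply: (@SchurZassenhaus_trans_sol _ I H (H :^ a)%G).
    - exact: pgroup_sol pI.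
    - exact: subset_trans sHA nIA.
    - by rewrite defK -(normsP (normal_norm nsKA) a Aa) conjSg.
    - exact: pnat_coprime pI p'H.
    by rewrite cardJg.
  rewrite -(mulgKV x a) mem_mulg // inE groupM ?groupV ?(subsetP sIA x) //.
  by apply/normP; rewrite conjsgM defHa conjsgK.
have sSNH : S \subset 'N(H).
  have /Phi_nongen defS : 'Phi(S) <*> 'N_S(H) = S.
    apply/eqP; rewrite eqEsubset join_subG Phi_sub subsetIl /=.
    apply/subsetP=> s Ss.
    have /mulsgP[n x] := subsetP Frat s (subsetP sSA s Ss).
    case/setIP=> An nHn Ix def_s.
    have NSn : n \in 'N_S(H).
      by rewrite inE nHn -(groupMr _ (subsetP sIS x Ix)) -def_s Ss.
    rewrite def_s groupM ?(subsetP (joing_subr _ _) n) //.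
    by rewrite (subsetP (joing_subl _ _)) ?(subsetP sIPhi).
  by rewrite -defS gen_subG subsetIr.
exists H; split=> //.
  rewrite /normal sHA (subset_trans Frat) // mul_subG ?subsetIr //.
  exact: subset_trans sIS sSNH.
apply/eqP; rewrite eqEsubset mul_subG //=.
have -> : A = K * S :> {set gT}.
  rewrite -(quotientGK nsIA) -defAb defKb -quotientMl ?(subset_trans sKA) //.
  have nIK := subset_trans sKA nIA.
  by rewrite quotientK ?mul_subG // mulgA (mulSGid sIK).
by rewrite -defK -(normC (subset_trans sHA nIA)) -mulgA (mulSGid sIS).
Qed.

End GroupTheory.

(** * Automorphisms of finite groups *)

(** If z = u^-1 * a u, then a ^+ k maps u to u * z ^+ k, so the order of z
divides that of a. *)
Lemma coprime_stable_aut (gT : finGroupType) (R Q : {group gT})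
    (a : {perm gT}) :
    Q \subset R -> a \in Aut R -> coprime #|R| #[a] ->
    {in Q, forall v, a v = v} -> {in R, forall u, u^-1 * a u \in Q} ->
  a = 1.
Proof.
move=> sQR Aa coRa fixQ dQ; apply: eq_Aut (Aa) (group1 _) _ => u Ru.
rewrite perm1; set z := u^-1 * a u; have Qz : z \in Q := dQ u Ru.
have aM : {in R &, {morph a : x y / x * y}} by apply/morphicP/Aut_morphic.
have aX k : (a ^+ k) u = u * z ^+ k.
  elim: k => [|k IHk]; first by rewrite perm1 mulg1.
  rewrite expgSr permM IHk aM ?groupX ?(subsetP sQR z) //.
  by rewrite (fixQ (z ^+ k)) ?groupX // expgS mulgA mulKVg.
have z1 : z = 1.
  rewrite -(expgK coRa (subsetP sQR z Qz)) /= (_ : z ^+ _ = 1) ?expg1n //.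
  by apply: (mulgI u); rewrite mulg1 -aX expg_order perm1.
by rewrite -[RHS]mulg1 -z1 mulKVg.
Qed.

Lemma conj_autJ (gT : finGroupType) (G : {group gT}) (a : {perm gT}) (q : gT) :
  a \in Aut G -> q \in G -> conj_aut G q ^ a = conj_aut G (a q).
Proof.
move=> Aa Gq; have Gaq : a q \in G by apply: Aut_closed.
have Ac x : x \in G -> conj_aut G x \in Aut G.
  move=> Gx; rewrite (subsetP (Aut_conj_aut G G)) // mem_morphim //.
  exact: (subsetP (normG G)).
have aM : {in G &, {morph a : x y / x * y}} by apply/morphicP/Aut_morphic.
apply: (@eq_Aut _ G); rewrite ?groupJ ?Ac // => u Gu.
have Gv : a^-1 u \in G by apply: Aut_closed Gu; rewrite groupV.
have aV : a q^-1 = (a q)^-1 := morphV (autm_morphism Aa) Gq.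
by rewrite conjgE !permM !conj_autE // !conjgE !aM ?groupM ?groupV // aV permKV.
Qed.

(** * Averaging crossed homomorphisms *)

(** P acts on H through conjugation by [conj_aut X], and [delta h] is a crossed
homomorphism from the stabilizer of h in P to 'Z(X). *)
Section Averaging.
Import FiniteModule GRing.Theory.

Variables (gT : finGroupType) (P X : {group gT}) (H : {group {perm gT}}).
Variable delta : {perm gT} -> gT -> gT.
Local Notation c := (conj_aut X).

Hypotheses (nsXP : X <| P) (sHA : H \subset Aut X).
Hypotheses (nHP : c @* P \subset 'N(H)).
Hypothesis deltaZ : forall h x,
  h \in H -> x \in P -> h ^ c x = h -> delta h x \in 'Z(X).
Hypothesis deltaM : forall h x y, h \in H -> x \in P -> y \in P ->
  h ^ c x = h -> h ^ c y = h -> delta h (x * y) = delta h x ^ y * delta h y.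
Hypothesis deltaE : forall h v, h \in H -> v \in 'Z(X) ->
  delta h v = v^-1 * h v.

Let nXP : P \subset 'N(X) := normal_norm nsXP.
Let nXPx x : x \in P -> x \in 'N(X) := subsetP nXP x.
Let abZ : abelian 'Z(X) := center_abelian X.
Let sZX : 'Z(X) \subset X := center_sub X.
Let sZP : 'Z(X) \subset P := subset_trans sZX (normal_sub nsXP).
Let nZP : P \subset 'N('Z(X)) := char_norm_trans (center_char X) nXP.
Let nZPx x : x \in P -> x \in 'N('Z(X)) := subsetP nZP x.
Local Notation M := (fmod_of abZ).

Let cM : {in P &, {morph c : x y / x * y}}.
Proof. by move=> x y Px Py; rewrite morphM ?nXPx. Qed.

Let cV : {in P, {morph c : x / x^-1}}.
Proof. by move=> x Px; rewrite morphV ?nXPx. Qed.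

Let HJ h x : x \in P -> (h ^ c x \in H) = (h \in H).
Proof.
by move=> Px; rewrite memJ_norm // (subsetP nHP) // mem_morphim ?nXPx.
Qed.

Let cZ v : v \in 'Z(X) -> c v = 1.
Proof.
move=> Zv; have Nv := nXPx (subsetP sZP v Zv).
by apply: mker; rewrite ker_conj_aut; case/setIP: Zv.
Qed.

Let Z_aut h v : h \in H -> v \in 'Z(X) -> h v \in 'Z(X).
Proof.
move=> Hh Zv; have Ah := subsetP sHA h Hh.
have := center_char X => /charP[_ /(_ _ (injm_autm Ah) (im_autm Ah)) <-].
by rewrite -(autmE Ah) mem_morphim // (subsetP sZX).
Qed.

Let autHM h : h \in H -> {in X &, {morph h : x y / x * y}}.
Proof. by move=> Hh; apply/morphicP/Aut_morphic/(subsetP sHA). Qed.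

(** The sum, over representatives of the P-orbits on H, of the corestrictions
of [delta h] from the stabilizer of h to P. The points of an orbit index the
cosets of the stabilizer, so that the double sum runs over H. *)
Lemma corestricted_crossed_hom : exists d : gT -> M,
  [/\ {in P &, forall x y, d (x * y)%g = (d x ^@ y + d y)%R}
    & forall v, v \in 'Z(X) ->
        d v = (\sum_(h in H) fmod abZ (h v) - fmod abZ v *+ #|H|)%R].
Proof.
pose S := (c @* P)%G; pose rho h := repr (h ^: S).
have rhoP h : rho h \in h ^: S by apply: mem_repr (class_refl _ _).
have rhoJ h x : x \in P -> rho (h ^ c x) = rho h.
  by move=> Px; rewrite /rho classGidl // mem_morphim ?nXPx.
have Hrho h : h \in H -> rho h \in H.
  by case/imsetP: (rhoP h) => _ /morphimP[x _ Px ->] ->; rewrite HJ.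
have /fin_all_exists2[t Pt tE] h : exists2 x, x \in P & rho h ^ c x = h.
  have := rhoP h; rewrite class_sym => /imsetP[_ /morphimP[x _ Px ->] hE].
  by exists x.
(* [rho h] represents the orbit of h and [t h] carries it to h; [u h x] is the
   factor in the stabilizer of [rho h] of the decomposition of t h * x. *)
pose u h x := t h * x * (t (h ^ c x))^-1.
have Pu h x : x \in P -> u h x \in P by move=> Px; rewrite !groupM ?groupV ?Pt.
have fixu h x : x \in P -> rho h ^ c (u h x) = rho h.
  move=> Px; rewrite /u !cM ?groupM ?groupV ?Pt // cV ?Pt // !conjgM tE.
  by rewrite -{1}(tE (h ^ c x)) conjgK rhoJ.
pose Delta h x := (fmod abZ (delta (rho h) (u h x)) ^@ t (h ^ c x))%R.
exists (fun x => \sum_(h in H) Delta h x)%R; split=> [x y Px Py | v Zv].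
  (* Delta h (x * y) = Delta h x ^@ y + Delta (h ^ c x) y, summed over H. *)
  rewrite actr_sum /= [X in (_ + X)%R](reindex_inj (conjg_inj (c x))) /=.
  rewrite [X in (_ + X)%R](eq_bigl (mem H)) => [|h]; last by rewrite HJ.
  rewrite -big_split /=; apply: eq_bigr => h Hh.
  rewrite /Delta -conjgM -cM // rhoJ //.
  have -> : u h (x * y) = u h x * u (h ^ c x) y.
    by rewrite /u -conjgM -cM // !mulgA mulgKV.
  have fuy : rho h ^ c (u (h ^ c x) y) = rho h.
    by rewrite -{1}(rhoJ h x Px) fixu ?rhoJ.
  rewrite deltaM ?Hrho ?Pu ?fixu //.
  rewrite fmodM ?memJ_norm ?deltaZ ?Hrho ?nZPx ?Pu ?fixu // actAr.
  congr (_ + _)%R.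
  rewrite fmodJ ?nZPx ?Pu // -!actrM ?nZPx ?Pu ?Pt //.
  by rewrite /u -conjgM -cM // mulgKV.
rewrite -sumr_const -sumrB; apply: eq_bigr => h Hh; rewrite /Delta.
have Pv := subsetP sZP v Zv; have Ph := Pt h.
have Zv' : v ^ (t h)^-1 \in 'Z(X) by rewrite memJ_norm // groupV nZPx.
rewrite /u cZ // conjg1.
have -> : t h * v * (t h)^-1 = v ^ (t h)^-1 by rewrite conjgE invgK mulgA.
rewrite deltaE ?Hrho // -fmodJ ?nZPx // conjMg conjVg conjgKV.
have -> : rho h (v ^ (t h)^-1) ^ t h = h v.
  have Xv := subsetP sZX v Zv.
  rewrite -[in RHS](tE h) conjgE !permM -cV //.
  rewrite (norm_conj_autE (nXPx (groupVr Ph)) Xv).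
  by rewrite norm_conj_autE ?nXPx // (subsetP sZX) ?Z_aut ?Hrho.
by rewrite addrC -fmodV fmodM ?groupV ?Z_aut.
Qed.

(** With d as above and C the fixed points of H in 'Z(X), the subgroup L of the
x in P with d x in C satisfies 'Z(X) * L = P: as d v = - #|H| v modulo C for v
in 'Z(X), the element d x / #|H| moves x into L. So L = P, and #|H| v lies in
C for all v in 'Z(X). *)
Lemma center_fixed_of_crossed_homs p : p.-group P -> p^'.-group H ->
    'Z(X) \subset 'Phi(P) ->
  forall h v, h \in H -> v \in 'Z(X) -> h v = v.
Proof.
move=> pP p'H sZPhi; have [d [dM dZ]] := corestricted_crossed_hom.
have coZH : coprime #|'Z(X)| #|H| := pnat_coprime (pgroupS sZP pP) p'H.
pose C := [set v in 'Z(X) | [forall h in H, h v == v]].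
have CP v : reflect (v \in 'Z(X) /\ forall h, h \in H -> h v = v) (v \in C).
  apply: (iffP setIdP) => [[Zv /forall_inP fv] | [Zv fv]].
    by split=> // h Hh; apply/eqP/fv.
  by split=> //; apply/forall_inP=> h Hh; rewrite fv.
have gC : group_set C.
  apply/group_setP; split=> [|v w /CP[Zv fv] /CP[Zw fw]].
    apply/CP; split=> [|h Hh]; first exact: group1.
    exact: (morph1 (autm_morphism (subsetP sHA h Hh))).
  apply/CP; split=> [|h Hh]; first exact: groupM.
  by rewrite autHM ?fv ?fw // (subsetP sZX).
pose Cg := Group gC.
have CJ v x : v \in C -> x \in P -> v ^ x \in C.
  move=> /CP[Zv fv] Px; apply/CP; split=> [|h Hh].
    by rewrite memJ_norm ?nZPx.
  have Xv := subsetP sZX v Zv.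
  rewrite -(norm_conj_autE (nXPx Px) Xv) -permM.
  have -> : c x * h = h ^ (c x)^-1 * c x by rewrite conjgE invgK mulgA mulgKV.
  by rewrite permM fv // -cV // HJ ?groupV.
pose norm v := fmval (\sum_(h in H) fmod abZ (h v))%R.
have norm_fixed v : v \in 'Z(X) -> norm v \in C.
  move=> Zv; rewrite /norm; rewrite fmval_sum; apply/CP; split=> [|k Hk].
    by apply: group_prod => h Hh; apply: fmodP.
  have Ak := subsetP sHA k Hk.
  have Xh h : h \in H -> fmval (fmod abZ (h v)) \in X.
    by move=> _; rewrite (subsetP sZX) ?fmodP.
  rewrite -(autmE Ak) morph_prod // -fmval_sum.
  rewrite [in RHS](reindex_inj (mulIg k)) /= fmval_sum.
  apply: eq_big => h; first by rewrite groupMr.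
  by move=> Hh; rewrite /= !fmodK ?Z_aut ?groupM // permM.
have dE v : v \in 'Z(X) ->
    exists2 w, w \in C & fmval (d v) = w * (v ^+ #|H|)^-1.
  move=> Zv; exists (norm v); first exact: norm_fixed.
  by rewrite dZ // fmvalA fmvalN fmvalZ fmodK.
have dMv x y : x \in P -> y \in P ->
    fmval (d (x * y)) = fmval (d x) ^ y * fmval (d y).
  by move=> Px Py; rewrite dM // fmvalA fmvalJ ?nZPx.
pose L := [set x in P | fmval (d x) \in Cg].
have gL : group_set L.
  apply/group_setP; split=> [|x y /setIdP[Px Cx] /setIdP[Py Cy]]; rewrite inE.
    suff -> : fmval (d 1) = 1 by rewrite !group1.
    apply: (mulgI (fmval (d 1))).
    by rewrite -{1}[fmval _]conjg1 -dMv // !mulg1.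
  by rewrite groupM // dMv // groupM //; apply: CJ.
pose n' := expg_invn 'Z(X) #|H|.
have expK v : v \in 'Z(X) -> (v ^+ n') ^+ #|H| = v.
  by move=> Zv; rewrite -expgM mulnC expgM; apply: (expgK coZH).
have sPL : P \subset 'Phi(P) <*> L.
  apply/subsetP=> x Px; pose v := fmval (d x) ^+ n'.
  have Zd : fmval (d x) \in 'Z(X) := fmodP _.
  have Zv : v \in 'Z(X) by apply: groupX.
  have Pv := subsetP sZP v Zv.
  have Lxv : x * v \in L.
    have [w Cw dv] := dE v Zv.
    rewrite inE groupM // dMv // dv expK //.
    have -> : fmval (d x) ^ v = fmval (d x).
      by apply/conjg_fixP/commgP/(centsP abZ).
    have /CP[Zw _] := Cw.
    by rewrite (centsP abZ w Zw _ (groupVr Zd)) mulKVg.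
  rewrite -(mulgK v x) groupM ?groupV //.
    by rewrite (subsetP (joing_subr _ _)).
  by rewrite (subsetP (joing_subl _ _)) ?(subsetP sZPhi).
have defL : L = P.
  have /Phi_nongen : 'Phi(P) <*> L = P.
    apply/eqP; rewrite eqEsubset sPL join_subG Phi_sub andbT.
    by apply/subsetP=> x /setIdP[].
  by rewrite (gen_set_id gL).
move=> h v Hh Zv; have : v \in L by rewrite defL (subsetP sZP).
case/setIdP=> _; have [w Cw ->] := dE v Zv.
rewrite (groupMl (G := Cg)) // groupV => Cv.
have /CP[_] : v \in Cg by rewrite -(expgK coZH Zv); apply: groupX.
exact.
Qed.

End Averaging.

(** * Morphisms of saturated fusion systems *)

Section FusionSystem.

Variables (p : nat) (gT : finGroupType) (P : {group gT}) (F : homsets gT).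
Hypothesis (satF : saturated p P F).
Implicit Types (D Q R S T : {group gT}) (f g : {ffun gT -> gT}).

Let catF := sat_category satF.

Lemma resfE Q (f : gT -> gT) : {in Q, resf Q f =1 f}.
Proof. by move=> x Qx; rewrite ffunE Qx. Qed.

Lemma eq_resf Q (f g : gT -> gT) : {in Q, f =1 g} -> resf Q f = resf Q g.
Proof. by move=> fg; apply/ffunP=> x; rewrite !ffunE; case: ifP => // /fg. Qed.

Section Morphisms.
Variables (R S : {group gT}) (f : {ffun gT -> gT}).
Hypotheses (sRP : R \subset P) (sSP : S \subset P) (Ff : f \in F R S).

Lemma hom_resf : resf R f = f.
Proof. by case: (cat_injhom catF sRP sSP Ff). Qed.

Lemma homM : {in R &, {morph f : x y / x * y}}.
Proof. by case: (cat_injhom catF sRP sSP Ff). Qed.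

Lemma hom_inj : {in R &, injective f}.
Proof. by case: (cat_injhom catF sRP sSP Ff). Qed.

Lemma hom_mem x : x \in R -> f x \in S.
Proof.
case: (cat_injhom catF sRP sSP Ff) => _ _ _ /subsetP sfS Rx.
by rewrite sfS ?imset_f.
Qed.

Lemma hom_widen T : S \subset T -> T \subset P -> f \in F R T.
Proof.
move=> sST sTP; have := cat_comp catF sRP sSP sTP Ff (sat_incl satF sTP sST).
rewrite (_ : resf R _ = f) // -[RHS]hom_resf; apply: eq_resf => x Rx /=.
by rewrite resfE ?hom_mem.
Qed.

Lemma hom_restrict T : T \subset R -> resf T f \in F T S.
Proof.
move=> sTR; have sTP := subset_trans sTR sRP.
have := cat_comp catF sTP sRP sSP (sat_incl satF sRP sTR) Ff.
by rewrite (@eq_resf T _ f) // => x Tx /=; rewrite resfE.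
Qed.

Lemma imgG_sub : imgG f R \subset S.
Proof.
by rewrite imgGE; [case: (cat_injhom catF sRP sSP Ff) | apply: homM].
Qed.

Lemma hom_corestrict : f \in F R (imgG f R).
Proof. by case: (sat_iso satF sRP sSP Ff). Qed.

End Morphisms.

Lemma aut_of_hom R f : R \subset P -> f \in F R P -> f @: R \subset R ->
  exists2 a, a \in autF F R & {in R, a =1 f}.
Proof.
move=> sRP Ff fR; have fM := homM sRP (subxx P) Ff.
have injf := hom_inj sRP (subxx P) Ff.
have imf : f @: R = R.
  by apply/eqP; rewrite eqEcard fR /= card_in_imset.
have FRf : f \in F R R.
  have imR : imgG f R = R by apply/val_inj; rewrite -[RHS]imf -imgGE.
  by rewrite -{2}imR; apply: hom_corestrict Ff.
have inj_f : 'injm (Morphism fM) by apply/injmP.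
have im_f : Morphism fM @* R = R.
  by rewrite morphimEdom.
exists (aut inj_f im_f) => [|x Rx]; last by rewrite autE.
rewrite inE Aut_aut (@eq_resf R _ f) ?(hom_resf sRP sRP FRf) // => x Rx.
by rewrite autE.
Qed.

Lemma autF_hom R a : a \in autF F R -> resf R a \in F R R.
Proof. by case/setIdP. Qed.

Lemma autF_group_set R : R \subset P -> group_set (autF F R).
Proof.
move=> sRP; apply/group_setP; split=> [|a b /setIdP[Aa Fa] /setIdP[Ab Fb]].
  rewrite inE group1; rewrite (@eq_resf _ _ id) ?(cat_id catF) // => x _.
  by rewrite perm1.
rewrite inE groupM //; have := cat_comp catF sRP sRP sRP Fa Fb.
rewrite (@eq_resf R _ (a * b)) // => x Rx /=.
by rewrite permM !resfE // Aut_closed.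
Qed.

Lemma autP_sub_autF R : R <| P -> autP P R \subset autF F R.
Proof.
move=> /andP[sRP nRP]; apply/subsetP=> _ /morphimP[x Nx /setIP[Px _] ->].
rewrite inE (subsetP (Aut_conj_aut R 'N(R))) ?mem_morphim //.
apply: (subsetP (sat_homP satF sRP sRP)); apply/imsetP; exists x.
  by rewrite inE Px (normP Nx) subxx.
by apply: eq_resf => u Ru; rewrite norm_conj_autE.
Qed.

(** The extension axiom for a normal image: the group N_f contains D as soon as
f transports the action on R of each element of D to that of some element of
P. *)
Lemma hom_extend R D f :
    R \subset P -> f \in F R P -> imgG f R <| P -> D \subset P ->
    R \subset D -> D \subset 'N(R) ->
    (forall x, x \in D -> exists2 y, y \in P &
       {in R, forall u, f (u ^ x) = f u ^ y}) ->
  exists2 g, g \in F D P & {in R, g =1 f}.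
Proof.
move=> sRP Ff /andP[sR'P nR'P] sDP sRD nRD trD.
have fM := homM sRP (subxx P) Ff.
have [] := sat_ext satF sRP Ff.
  move=> S sSP _; apply: subset_leq_card.
  by rewrite (setIidPl nR'P) subsetIl.
move=> g Fg gf; have sDN : D \subset Nphi P R f.
  rewrite NphiE //; apply/subsetP=> x Dx; have [y Py xy] := trD x Dx.
  have Nx := subsetP nRD x Dx; have Px := subsetP sDP x Dx.
  have NRx : x \in 'N_P(R) by rewrite inE Px.
  rewrite inE NRx inE Nx /= inE.
  apply/setIP; split; first exact: mem_morphim.
  rewrite inE (subsetP (Aut_conj_aut R 'N(R))) ?mem_morphim //=.
  have Ny := subsetP nR'P y Py.
  apply/existsP; exists (conj_aut (imgG f R) y); apply/andP; split.
    by rewrite mem_morphim // inE Py.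
  apply/forall_inP=> u Ru; apply/eqP; rewrite !norm_conj_autE ?xy //.
  by rewrite -[_ \in _]/(f u \in (imgG f R : {set gT})) imgGE // imset_f.
have sNP : Nphi P R f \subset P.
  by rewrite NphiE // /Nphi_set -setIA subsetIl.
exists (resf D g); first exact: hom_restrict Fg _ _.
by move=> u Ru; rewrite resfE ?(subsetP sRD) // -gf resfE.
Qed.

Lemma hom_inner_of_NF_trivial f :
  trivial_fusion P (normF P F P) -> f \in F P P ->
  exists2 x, x \in P & {in P, forall u, f u = u ^ x}.
Proof.
move=> triv Ff.
have : f \in homP P P P.
  rewrite -triv // inE Ff subsetI subxx normG /=.
  apply/existsP; exists f; rewrite (hom_resf _ _ Ff) // eqxx /=.
  have -> : (P * P)%G = P by apply/val_inj; rewrite /= -genM_join mulGid genGid.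
  rewrite Ff /= eqEcard.
  have [_ _ injf ->] := cat_injhom catF (subxx P) (subxx P) Ff.
  by rewrite /= card_in_imset.
by case/imsetP=> x /setIdP[Px _] ->; exists x => // u Pu; rewrite resfE.
Qed.

End FusionSystem.

(** * Subgroups that contain P' *)

Section OverDerived.

Variables (p : nat) (gT : finGroupType) (P Q : {group gT}) (F : homsets gT).
Hypotheses (pP : p.-group P) (satF : saturated p P F).
Hypothesis autFP : forall f : {ffun gT -> gT}, f \in F P P ->
  exists2 x, x \in P & {in P, forall u, f u = u ^ x}.
Hypotheses (sQP : Q \subset P) (sP'Q : P^`(1) \subset Q).
Implicit Types (D R S T : {group gT}) (f g : {ffun gT -> gT}).

Let catF := sat_category satF.
Let sPP := subxx P.

Let normal_over R : Q \subset R -> R \subset P -> R <| P.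
Proof.
move=> sQR sRP; rewrite /normal sRP.
by apply: sub_der1_norm; first exact: subset_trans sP'Q sQR.
Qed.

Lemma autPE R : R <| P -> autP P R = conj_aut R @* P.
Proof. by case/andP=> _ nRP; rewrite /autP (setIidPl nRP). Qed.

Lemma autP_conj R x : R <| P -> x \in P -> conj_aut R x \in autP P R.
Proof.
by move=> nsRP Px; rewrite autPE // mem_morphim ?(subsetP (normal_norm nsRP)).
Qed.

Lemma autPP R a : R <| P -> a \in autP P R ->
  exists2 x, x \in P & a = conj_aut R x.
Proof. by move=> nsRP; rewrite autPE // => /morphimP[x _ Px ->]; exists x. Qed.

(** Such an f extends to P, and there it is inner. *)
Lemma hom_inner_of_transport R f : Q \subset R -> R \subset P -> f \in F R P ->
    Q \subset imgG f R ->
    (forall x, x \in P -> exists2 y, y \in P &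
       {in R, forall u, f (u ^ x) = f u ^ y}) ->
  exists2 z, z \in P & {in R, forall u, f u = u ^ z}.
Proof.
move=> sQR sRP Ff sQfR trf; have [_ nRP] := andP (normal_over sQR sRP).
have nsfR := normal_over sQfR (imgG_sub satF sRP sPP Ff).
have [g Fg gf] := hom_extend satF sRP Ff nsfR sPP sRP nRP trf.
have [z Pz gz] := autFP Fg.
by exists z => // u Ru; rewrite -gf // gz // (subsetP sRP).
Qed.

(** An automorphism that normalizes Aut_P(R) carries the action on R of each
element of P to that of some element of P, so [hom_inner_of_transport] applies
to it. *)
Lemma autP_self_normalizing R : Q \subset R -> R \subset P ->
  'N_(autF F R)(autP P R) \subset autP P R.
Proof.
move=> sQR sRP; have nsRP := normal_over sQR sRP; have [_ nRP] := andP nsRP.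
apply/subsetP=> a /setIP[Fa Na]; have [Aa Ra] := setIdP Fa.
have imR : imgG (resf R a) R = R.
  apply/val_inj; rewrite /= -[RHS](im_autm Aa) morphimEdom.
  rewrite -[LHS]/(imgG (resf R a) R : {set gT}) imgGE; first last.
    by have := homM satF sRP sRP Ra.
  by apply: eq_in_imset => u Ru; rewrite resfE.
have [||x Px|z Pz az] := @hom_inner_of_transport R (resf R a) sQR sRP.
- by have := hom_widen satF sRP sRP Ra sRP sPP.
- by rewrite imR.
- have : conj_aut R x ^ a \in autP P R by rewrite memJ_norm ?autP_conj.
  case/(autPP nsRP)=> y Py cy; exists y => // u Ru.
  have Rau : a u \in R by apply: Aut_closed.
  rewrite !resfE ?memJ_norm ?(subsetP nRP) //.
  rewrite -(norm_conj_autE (subsetP nRP x Px) Ru) -permM.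
  rewrite -(norm_conj_autE (subsetP nRP y Py) Rau) -permM -cy.
  by rewrite conjgE mulKVg.
have -> : a = conj_aut R z; last exact: autP_conj.
apply: eq_Aut Aa _ _ => [|u Ru].
  by rewrite (subsetP (Aut_conj_aut R P)) // mem_morphim ?(subsetP nRP).
by rewrite norm_conj_autE ?(subsetP nRP) // -az // resfE.
Qed.

(** Denoted K_R in the comments. *)
Definition autF_mod R :=
  [set a in autF F R | [forall u in R, u^-1 * a u \in Q]].

Lemma autF_modP R a :
  reflect (a \in autF F R /\ {in R, forall u, u^-1 * a u \in Q})
          (a \in autF_mod R).
Proof. by apply: (iffP setIdP) => -[Fa /forall_inP dQ]; split; auto. Qed.

Lemma autF_mod_group_set R : R \subset P -> group_set (autF_mod R).
Proof.
move=> sRP; have gF := autF_group_set satF sRP.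
apply/group_setP; split=> [|a b /autF_modP[Fa aQ] /autF_modP[Fb bQ]].
  apply/autF_modP; split=> [|u Ru]; first exact: (@group1 _ (Group gF)).
  by rewrite perm1 mulVg.
apply/autF_modP; split=> [|u Ru]; first exact: (@groupM _ (Group gF)).
have Rau : a u \in R by apply: Aut_closed Ru; case/setIdP: Fa.
have -> : u^-1 * (a * b) u = (u^-1 * a u) * ((a u)^-1 * b (a u)).
  by rewrite permM mulgA mulgK.
by rewrite groupM ?aQ ?bQ.
Qed.

(** P acts trivially on R / Q as Q contains P'. In a p-group, a self-normalizing
subgroup is the whole group. *)
Lemma autF_mod_Sylow R (sRP : R \subset P) : Q \subset R ->
  p.-Sylow(Group (autF_mod_group_set sRP)) (autP P R).
Proof.
move=> sQR; have nsRP := normal_over sQR sRP; have [_ nRP] := andP nsRP.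
have pA : p.-group (autP P R).
  by rewrite autPE // morphim_pgroup.
have sAK : autP P R \subset Group (autF_mod_group_set sRP).
  apply/subsetP=> a Pa; apply/autF_modP; split.
    exact: subsetP (autP_sub_autF satF nsRP) _ Pa.
  have [x Px ->] := autPP nsRP Pa => u Ru.
  rewrite norm_conj_autE ?(subsetP nRP) // -commgEl (subsetP sP'Q) //.
  by rewrite mem_commg ?(subsetP sRP u).
have [T sylT sAT] := Sylow_superset sAK pA.
have [sTK pT _] := and3P sylT.
have defT : T :=: (conj_aut R @* 'N_P(R))%G.
  apply: nilpotent_sub_norm (pgroup_nil pT) sAT _.
  apply: subset_trans (autP_self_normalizing sQR sRP); apply: setSI.
  by apply: subset_trans sTK _; apply/subsetP=> a /autF_modP[].
by rewrite /autP -defT.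
Qed.

(** Let R' = f(R). The p-group f Aut_P(R) f^-1 acts trivially on R' / Q, so some
k in K_{R'} conjugates it into Aut_P(R'). Then k o f is conjugation by an
element of P, and both it and k act trivially modulo Q. *)
Lemma hom_trivial_mod R f : Q \subset R -> R \subset P -> f \in F R P ->
  f @: Q = Q -> {in R, forall u, u^-1 * f u \in Q}.
Proof.
move=> sQR sRP Ff fQ.
have nsRP := normal_over sQR sRP; have [_ nRP] := andP nsRP.
have fM := homM satF sRP sPP Ff; have finj := hom_inj satF sRP sPP Ff.
have sR'P := imgG_sub satF sRP sPP Ff.
have F'f := hom_corestrict satF sRP sPP Ff.
have [_ [g Fg fK]] := sat_iso satF sRP sPP Ff.
set R' := imgG f R in sR'P F'f Fg.
have defR' : R' = f @: R :> {set gT} by apply: imgGE.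
have sQR' : Q \subset R' by rewrite defR' -fQ imsetS.
have Rf u : u \in R -> f u \in R' by move=> Ru; rewrite defR' imset_f.
pose fm := Morphism fM; have injf : 'injm fm by apply/injmP.
have fmR : fm @* R = R' by rewrite morphimEdom.
pose T := (Aut_isom injf (subxx R) @* (conj_aut R @* 'N_P(R)))%G.
have sTK : T \subset Group (autF_mod_group_set sR'P).
  apply/subsetP=> _ /morphimP[a Aa Pa ->].
  have {Pa} [x Px def_a] := autPP nsRP Pa.
  have tE : {in R, forall u, Aut_isom injf (subxx R) a (f u) = f (u ^ x)}.
    move=> u Ru; have := Aut_isomE injf (subxx R) Aa Ru; rewrite /= => ->.
    by rewrite def_a norm_conj_autE ?(subsetP nRP).
  set b := Aut_isom _ _ a in tE *.
  have FRa : resf R a \in F R R.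
    apply: autF_hom; rewrite def_a (subsetP (autP_sub_autF satF nsRP)) //.
    exact: autP_conj.
  have Ab : b \in Aut R' by rewrite -fmR Aut_Aut_isom.
  apply/autF_modP; split.
    rewrite inE Ab.
    have FRgb := cat_comp catF sR'P sRP sRP Fg FRa.
    have := cat_comp catF sR'P sRP sR'P FRgb F'f.
    rewrite (@eq_resf _ _ _ b) // => w; rewrite defR' => /imsetP[u Ru ->].
    rewrite /= resfE ?Rf //= fK // resfE // tE // def_a.
    by rewrite norm_conj_autE ?(subsetP nRP).
  move=> w; rewrite defR' => /imsetP[u Ru ->].
  rewrite tE //.
  have -> : (f u)^-1 * f (u ^ x) = f (u^-1 * u ^ x).
    have Rux : u ^ x \in R by rewrite memJ_norm ?(subsetP nRP).
    by apply: (mulgI (f u)); rewrite mulKVg -fM ?mulKVg // groupM ?groupV.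
  rewrite -fQ imset_f // -commgEl (subsetP sP'Q) // mem_commg //.
  exact: (subsetP sRP).
have pT : p.-group T by rewrite !morphim_pgroup // (pgroupS _ pP) // subsetIl.
have [k /autF_modP[Fk kQ] sTkS] :=
  Sylow_Jsub (autF_mod_Sylow sR'P sQR') sTK pT.
have [Ak FRk] := setIdP Fk.
pose fk := resf R (resf R' k \o f).
have fkE : {in R, fk =1 k \o f} by move=> u Ru; rewrite !resfE //= resfE ?Rf.
have Ffk : fk \in F R R' := cat_comp catF sRP sR'P sR'P F'f FRk.
have FfkP := hom_widen satF sRP sR'P Ffk sR'P sPP.
have [|x Px|z Pz fkz] := hom_inner_of_transport sQR sRP FfkP.
- rewrite imgGE; last by have := homM satF sRP sR'P Ffk.
  apply/subsetP=> q /(subsetP sQR'); rewrite -{1}(im_autm Ak) morphimEdom.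
  case/imsetP=> w R'w ->; have := R'w; rewrite {1}defR' => /imsetP[u Ru ->].
  by apply/imsetP; exists u; rewrite ?fkE.
- have nsR'P := normal_over sQR' sR'P.
  set b := Aut_isom injf (subxx R) (conj_aut R x).
  have Ax : conj_aut R x \in Aut R.
    by rewrite (subsetP (Aut_conj_aut R P)) // mem_morphim ?(subsetP nRP).
  have : b ^ k \in autP P R'.
    by rewrite (subsetP sTkS) // memJ_conjg mem_morphim ?autP_conj.
  case/(autPP nsR'P) => y Py cy; exists y => // u Ru.
  have Rkfu : k (f u) \in R' by rewrite Aut_closed ?Rf.
  have Nx := subsetP nRP x Px; have Ny := subsetP (normal_norm nsR'P) y Py.
  rewrite !fkE ?memJ_norm //= -(norm_conj_autE Nx Ru).
  have := Aut_isomE injf (subxx R) Ax Ru; rewrite /= => <-.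
  by rewrite -/b -(norm_conj_autE Ny Rkfu) -cy conjgE !permM permK.
move=> u Ru.
have -> : u^-1 * f u = (u^-1 * fk u) * ((f u)^-1 * k (f u))^-1.
  by rewrite fkE //= invMg invgK mulgA mulgK.
rewrite groupM ?groupV ?kQ ?Rf // fkz // -commgEl (subsetP sP'Q) //.
by rewrite mem_commg ?(subsetP sRP u).
Qed.

Hypothesis sQPhi : Q \subset 'Phi(P).

Let nsQP : Q <| P := normal_over (subxx Q) sQP.
Let nQP : P \subset 'N(Q) := normal_norm nsQP.
Let NQx x : x \in P -> x \in 'N(Q) := subsetP nQP x.
Let NQQ x : x \in Q -> x \in 'N(Q) := subsetP (normG Q) x.

(** The image of Q in Aut Q is normal in Aut_F(Q), since conjugation by a
replaces q by a q. It contains the derived subgroup of Aut_P(Q) and lies in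
its Frattini subgroup, because P' <= Q <= Phi(P). *)
Lemma autF_base_complement : exists H : {group {perm gT}},
  [/\ H \subset autF F Q, p^'.-group H, conj_aut Q @* P \subset 'N(H),
      H \subset 'C(conj_aut Q @* Q) & H * autP P Q = autF F Q].
Proof.
pose A := Group (autF_mod_group_set sQP).
have defA : A = autF F Q :> {set _}.
  apply/setP=> a; apply/autF_modP/idP=> [[] // | Fa]; split=> // u Qu.
  by have [Aa _] := setIdP Fa; rewrite groupM ?groupV ?Aut_closed.
have sAA a : a \in A -> a \in Aut Q by rewrite defA => /setIdP[].
pose S := (conj_aut Q @* P)%G; pose I := (conj_aut Q @* Q)%G.
have defS : autP P Q = S by apply: autPE.
have sylS : p.-Sylow(A) S.
  by have := autF_mod_Sylow sQP (subxx Q); rewrite defS.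
have [sSA pS _] := and3P sylS.
have sIS : I \subset S by apply: morphimS.
have nsIA : I <| A.
  rewrite /normal (subset_trans sIS sSA); apply/subsetP=> a /sAA Aa.
  rewrite inE; apply/subsetP=> _ /imsetP[_ /morphimP[q Nq Qq ->] ->].
  by rewrite conj_autJ // mem_morphim ?NQQ ?Aut_closed.
have [||| H [nsHA p'H defHS]] :=
    @normal_complement_of_Frattini p _ A S I sylS _ nsIA.
- by rewrite defA -defS autP_self_normalizing.
- by rewrite -(morphim_Phi _ pP nQP) morphimS.
- by rewrite -morphim_der // morphimS.
have [sHA nHA] := andP nsHA; exists H; rewrite -defA defS defHS sHA.
split=> //; first exact: subset_trans sSA nHA.
(* H and I are normal subgroups of A of coprime orders. *)
have tiHI : H :&: I = 1.
  by rewrite setIC coprime_TIg // (pnat_coprime (pgroupS sIS pS)).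
rewrite (sameP commG1P trivgP) -tiHI commg_subI // subsetI subxx /=.
  exact: subset_trans sHA (normal_norm nsIA).
exact: subset_trans (normal_sub nsIA) nHA.
Qed.

(** The morphism h extends to [e h] on its stabilizer [D h] in P, and
x |-> x^-1 * e h x is the crossed homomorphism to be averaged. Its values are
in Q because [e h] acts trivially modulo Q, and they centralize Q because
x commutes with h on Q. *)
Lemma p'_autF_base_trivial (H : {group {perm gT}}) :
    H \subset autF F Q -> p^'.-group H -> conj_aut Q @* P \subset 'N(H) ->
    H \subset 'C(conj_aut Q @* Q) ->
  H :=: 1.
Proof.
move=> sHF p'H nHP cHQ; have sHA : H \subset Aut Q.
  by apply: subset_trans sHF _; apply/subsetP=> h /setIdP[].
have conj_fix h u : h \in H -> u \in P -> h ^ conj_aut Q u = h ->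
    {in Q, forall v, h (v ^ u) = h v ^ u}.
  move=> Hh Pu /conjg_fixP/commgP hu v Qv.
  have Qhv : h v \in Q by rewrite Aut_closed // (subsetP sHA).
  rewrite -(norm_conj_autE (NQx Pu) Qv) -(norm_conj_autE (NQx Pu) Qhv).
  by rewrite -!permM hu.
have fixQ h q : h \in H -> q \in Q -> h ^ conj_aut Q q = h.
  move=> Hh Qq; apply/conjg_fixP/commgP/(centsP cHQ) => //.
  by rewrite mem_morphim ?NQQ.
have imH h : h \in H -> h @: Q = Q.
  move=> Hh; have Ah := subsetP sHA h Hh.
  by rewrite -[RHS](im_autm Ah) morphimEdom.
pose D h := ('N_P(Q) :&: conj_aut Q @*^-1 'C[h])%G.
have DP h x : x \in P -> (x \in D h) = (h ^ conj_aut Q x == h).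
  move=> Px; rewrite !in_setI Px NQx //= in_set.
  rewrite (sameP cent1P commgP) (sameP eqP conjg_fixP).
  by apply/commgP/commgP => /commute_sym.
have QDh h : h \in H -> Q \subset D h.
  move=> Hh; apply/subsetP=> q Qq.
  by rewrite DP ?fixQ // (subsetP sQP).
have sDP h : D h \subset P by rewrite /D /= -setIA subsetIl.
have diffZ h x y : h \in H -> x \in P -> x^-1 * y \in Q ->
    {in Q, forall v, h v ^ y = h v ^ x} -> x^-1 * y \in 'Z(Q).
  move=> Hh Px Qxy hxy; rewrite inE Qxy; apply/centP=> w Qw.
  have : w ^ x^-1 \in Q by rewrite memJ_norm // groupV NQx.
  rewrite -{1}(imH h Hh) => /imsetP[v Qv hv].
  apply/commute_sym/commgP/conjg_fixP.
  by rewrite conjgM hv hxy // -hv conjgKV.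
have /fin_all_exists[e eP] (h : {perm gT}) : exists g : {ffun gT -> gT},
    h \in H -> g \in F (D h) P /\ {in Q, g =1 h}.
  have [Hh | _] := boolP (h \in H); last by exists [ffun => 1].
  have FQh := autF_hom (subsetP sHF h Hh).
  have imQ : imgG (resf Q h) Q = Q.
    apply/val_inj; rewrite -[RHS](imH h Hh) -[LHS]/(imgG _ _ : {set gT}) imgGE.
      by apply: eq_in_imset => u Qu; rewrite resfE.
    by have := homM satF sQP sQP FQh.
  have FQPh := hom_widen satF sQP sQP FQh sQP sPP.
  have [||x Dx|g Fg gh] := hom_extend satF sQP FQPh _ (sDP h) (QDh h Hh).
  - by rewrite imQ.
  - exact: subset_trans (sDP h) nQP.
  - have Px := subsetP (sDP h) x Dx; exists x => // u Qu.
    rewrite DP // in Dx.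
    by rewrite !resfE ?memJ_norm ?NQx // conj_fix //; apply/eqP.
  by exists g => _; split=> // u Qu; rewrite gh // resfE.
have fixZ : forall h v, h \in H -> v \in 'Z(Q) -> h v = v.
  pose delta h x := x^-1 * e h x.
  apply: (@center_fixed_of_crossed_homs _ P Q H delta _ _ _ _ _ _ p) => //.
  - move=> h x Hh Px hx; have [Fg gh] := eP h Hh.
    have Dx : x \in D h by rewrite DP // hx.
    have gM := homM satF (sDP h) sPP Fg.
    apply: (diffZ h) => //.
      apply: (hom_trivial_mod (QDh h Hh) (sDP h) Fg) => //.
      by rewrite (eq_in_imset gh) imH.
    move=> v Qv; rewrite -gh //; have Dv := subsetP (QDh h Hh) v Qv.
    rewrite -[LHS](morphJ (Morphism gM)) //= !gh ?memJ_norm ?NQx //.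
    exact: conj_fix.
  - move=> h x y Hh Px Py hx hy; have [Fg gh] := eP h Hh.
    rewrite /delta (homM satF (sDP h) sPP Fg) ?DP ?hx ?hy //.
    by rewrite invMg conjgE !mulgA mulgK.
  - move=> h v Hh Zv; rewrite /delta; have [_ ->] := eP h Hh => //.
    exact: subsetP (center_sub Q) v Zv.
  exact: subset_trans (center_sub Q) sQPhi.
apply/trivgP/subsetP=> h Hh; rewrite inE; apply/eqP.
have Ah := subsetP sHA h Hh.
apply: (@coprime_stable_aut _ Q 'Z(Q)%G) => //; first exact: center_sub.
- by rewrite (pnat_coprime (pgroupS sQP pP)) //; apply: mem_p_elt p'H Hh.
- by move=> v; apply: fixZ.
(* As h commutes with conjugation by u, h u and u act alike on Q. *)
move=> u Qu; apply: (diffZ h) => //.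
- exact: (subsetP sQP).
- by rewrite groupM ?groupV ?Aut_closed.
move=> v Qv; rewrite -(conj_fix h u) ?fixQ ?(subsetP sQP u) //.
exact/esym/(morphJ (autm_morphism Ah)).
Qed.

Lemma autF_base_inner : autF F Q \subset autP P Q.
Proof.
have [H [sHF p'H nHP cHQ <-]] := autF_base_complement.
by rewrite (p'_autF_base_trivial sHF p'H nHP cHQ) mul1g.
Qed.

(** Here f is an element of K_R, of which Aut_P(R) is a Sylow subgroup. An
element b of K_R of prime order other than p acts on Q as some x in P; by
coprimality it fixes Q pointwise, and so it is trivial. Thus K_R is a
p-group. *)
Lemma hom_inner R f : Q \subset R -> R \subset P -> f \in F R P -> f @: Q = Q ->
  exists2 x, x \in P & {in R, forall u, f u = u ^ x}.
Proof.
move=> sQR sRP Ff fQ; have nsRP := normal_over sQR sRP.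
have fR := hom_trivial_mod sQR sRP Ff fQ.
have [|a Fa af] := aut_of_hom satF sRP Ff.
  apply/subsetP=> _ /imsetP[u Ru ->].
  by rewrite -(mulKVg u (f u)) groupM // (subsetP sQR) ?fR.
pose K := Group (autF_mod_group_set sRP).
have Ka : a \in K by apply/autF_modP; split=> // u Ru; rewrite af ?fR.
have pK : p.-group K.
  apply/pgroupP=> q q_pr /(Cauchy q_pr)[b /autF_modP[Fb bQ] ob].
  apply/idPn=> p'q; have [Ab FRb] := setIdP Fb.
  have coPq : coprime #|P| q by rewrite (pnat_coprime pP) // pnatE.
  have sbQ : b @: Q \subset Q.
    apply/subsetP=> _ /imsetP[u Qu ->]; have Ru := subsetP sQR u Qu.
    by rewrite -(mulKVg u (b u)) groupM // bQ.
  have FPb := hom_widen satF sRP sRP FRb sRP sPP.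
  have FQb := hom_restrict satF sRP sPP FPb sQR.
  have [|c Fc cb] := aut_of_hom satF sQP FQb.
    apply: subset_trans sbQ; apply/subsetP=> _ /imsetP[u Qu ->].
    by rewrite !resfE ?(subsetP sQR) // imset_f.
  have [x Px cx] := autPP nsQP (subsetP autF_base_inner c Fc).
  have bx v : v \in Q -> b v = v ^ x.
    move=> Qv; have := cb v Qv; rewrite !resfE ?(subsetP sQR) // => <-.
    by rewrite cx norm_conj_autE ?NQx.
  have bxk k v : v \in Q -> (b ^+ k) v = v ^ (x ^+ k).
    move=> Qv; elim: k => [|k IHk]; first by rewrite perm1 conjg1.
    rewrite !expgSr permM IHk bx ?conjgM //.
    by rewrite memJ_norm // NQx ?groupX.
  have xC : x \in 'C(Q).
    rewrite -(expgK coPq Px) groupX //; apply/centP=> v Qv.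
    apply/commute_sym/commgP/conjg_fixP.
    by rewrite -ob /= -bxk // expg_order perm1.
  have b1 : b = 1.
    apply: (coprime_stable_aut sQR Ab) => //.
      by rewrite ob (coprime_dvdl (cardSg sRP)).
    by move=> v Qv; rewrite bx // /conjg -(centP xC v Qv) mulKg.
  by move: q_pr; rewrite -ob b1 order1.
have [x Px ax] : exists2 x, x \in P & a = conj_aut R x.
  apply: autPP => //; have := Ka.
  by rewrite -(pHall_id (autF_mod_Sylow sRP sQR) pK).
exists x => // u Ru.
by rewrite -af // ax norm_conj_autE // (subsetP (normal_norm nsRP)).
Qed.

End OverDerived.

(** * Triviality of N_F(Q) *)

Theorem theorem4p4 (p : nat) (gT : finGroupType) (P : {group gT})
    (F : homsets gT) (p_prime : prime p) (pP : p.-group P)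
    (satF : saturated p P F) (NFP_trivial : trivial_fusion P (normF P F P))
    (Q : {group gT}) (sP'Q : P^`(1) \subset Q) (sQPhi : Q \subset 'Phi(P)) :
  trivial_fusion P (normF P F Q).
Proof.
have sQP : Q \subset P := subset_trans sQPhi (Phi_sub P).
have nQP : P \subset 'N(Q) := sub_der1_norm sP'Q sQP.
have joinQ (R : {group gT}) : R \subset P ->
    [/\ Q \subset (Q * R)%G, R \subset (Q * R)%G & (Q * R)%G \subset P].
  by move=> sRP; rewrite join_subG joing_subl joing_subr sQP.
move=> R S sRP sSP; apply/setP=> f.
have [sQQR sRQR sQRP] := joinQ R sRP; have [_ _ sQSP] := joinQ S sSP.
rewrite inE (setIidPl nQP) sRP sSP /=; apply/andP/imsetP.
  case=> Ff /existsP[g /and3P[Fg /eqP gf /eqP gQ]].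
  have FgP := hom_widen satF sQRP sQSP Fg sQSP (subxx P).
  have autFP (k : {ffun gT -> gT}) :=
    @hom_inner_of_NF_trivial _ _ _ _ satF k NFP_trivial.
  have [x Px gx] := hom_inner pP satF autFP sQP sP'Q sQPhi
    sQQR sQRP FgP gQ.
  have fx : {in R, forall u, f u = u ^ x}.
    by move=> u Ru; rewrite -gf resfE // gx // (subsetP sRQR).
  exists x; last by rewrite -(hom_resf satF sRP sSP Ff); apply: eq_resf.
  rewrite inE Px; apply/subsetP=> _ /imsetP[u Ru ->].
  by rewrite -fx // (hom_mem satF sRP sSP Ff).
case=> x /setIdP[Px sRxS] ->; have Nx := subsetP nQP x Px; split.
  apply: (subsetP (sat_homP satF sRP sSP)); apply/imsetP; exists x => //.
  by rewrite inE Px.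
apply/existsP; exists (resf (Q * R)%G (conjg^~ x)); apply/and3P; split.
- apply: (subsetP (sat_homP satF sQRP sQSP)); apply/imsetP; exists x => //.
  rewrite inE Px /= -genJ conjUg (normP Nx) genS //.
  exact: setUS.
- apply/eqP/eq_resf => u Ru; rewrite resfE //; exact: (subsetP sRQR).
apply/eqP; rewrite -[RHS](normP Nx); apply: eq_in_imset => u Qu.
by rewrite resfE // (subsetP sQQR).
Qed.
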